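(* Assume that the cardinal $\mathfrak{c}=2^{\aleph_0}$ is regular. Then for every generalized Luzin set $L\subseteq 2^\omega$ and every generalized Sierpiński set $S\subseteq 2^\omega$ we have $L+S\in u_0$.
   Context: For a $\sigma$-ideal $\mathcal{I}$ of subsets of $2^\omega$, a set $L\subseteq 2^\omega$ is an $\mathcal{I}$-Luzin set if $|L\cap A|<|L|$ for every $A\in\mathcal{I}$. Generalized Luzin sets are the $\mathcal{M}$-Luzin sets, where $\mathcal{M}$ is the $\sigma$-ideal of meager subsets of $2^\omega$; generalized Sierpiński sets are the $\mathcal{N}$-Luzin sets, where $\mathcal{N}$ is the $\sigma$-ideal of null subsets of $2^\omega$ (with respect to the standard product measure). A tree is a nonempty set $T\subseteq 2^{<\omega}$ closed under initial segments. Write $\mathrm{split}(T)=\{\sigma\in T:\sigma^\frown 0\in T\text{ and }\sigma^\frown 1\in T\}$ and $[T]=\{x\in 2^\omega:(\forall n\in\omega)\ x\upharpoonright n\in T\}$. $T$ is perfect if for every $\sigma\in T$ there is $\tau\in\mathrm{split}(T)$ with $\sigma\subseteq\tau$. $T$ is uniformly perfect if it is perfect and for every $n\in\omega$ either $2^n\cap T\subseteq\mathrm{split}(T)$ or $2^n\cap\mathrm{split}(T)=\emptyset$. A set $A\subseteq 2^\omega$ belongs to $u_0$ if for every uniformly perfect tree $T$ there is a uniformly perfect tree $T'\subseteq T$ with $[T']\cap A=\emptyset$. On $2^\omega$, $+$ is coordinatewise addition modulo $2$, and $A+B=\{a+b:a\in A,\ b\in B\}$. *)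

(* Defs.v *)
From HB Require Import structures.
From mathcomp Require Import all_boot all_order all_algebra.
From mathcomp Require Import all_classical all_reals all_analysis.
From mathcomp Require Import ring lra zify.

Set Implicit Arguments.
Unset Strict Implicit.
Unset Printing Implicit Defensive.

Import Order.TTheory GRing.Theory Num.Theory.
Import numFieldNormedType.Exports.

Local Open Scope classical_set_scope.
Local Open Scope ring_scope.
Local Open Scope card_scope.

Definition card_lt (T U : Type) (A : set T) (B : set U) : Prop :=
  A #<= B /\ ~ (B #<= A).

(* |T| is regular: it is infinite, and a union of fewer than |T| sets, each of
   size less than |T|, has size less than |T|.  Up to bijection the index set
   and the members of such a family are subsets of T, so nothing is lost by
   only considering families of that kind. *)
Definition regular_card (T : Type) : Prop :=
  infinite_set [set: T] /\
  forall (I : set T) (F : T -> set T),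
    card_lt I [set: T] ->
    (forall i, I i -> card_lt (F i) [set: T]) ->
    card_lt (\bigcup_(i in I) F i) [set: T].

Definition luzin (X : Type) (I : set (set X)) (L : set X) : Prop :=
  forall A, I A -> card_lt (L `&` A) L.

Definition nowhere_dense (X : topologicalType) (A : set X) : Prop :=
  interior (closure A) = set0.

Definition meager (X : topologicalType) : set (set X) :=
  [set A | exists2 F : nat -> set X,
    (forall n, nowhere_dense (F n)) & A `<=` \bigcup_n F n].

(* The product sigma-algebra on 2^omega: the one generated by the coordinate
   projections. *)
Definition coordinate_sets : set (set cantor_space) :=
  [set A | exists n (B : set bool), A = [set x | B (x n)]].

HB.instance Definition _ :=
  Measurable.copy cantor_space (g_sigma_algebraType coordinate_sets).

Definition box (n : nat) (A : nat -> set bool) : set cantor_space :=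
  [set x | forall i, (i < n)%N -> A i (x i)].

Definition is_product_measure (R : realType)
    (mu : {measure set cantor_space -> \bar R}) : Prop :=
  forall n (A : nat -> set bool),
    mu (box n A) = (\prod_(i < n) bernoulli_prob (2^-1 : R) (A i))%E.

Section ProductMeasure.
Context (R : realType).

(* Binary digits of x; the image of Lebesgue measure on [0, 1[ under this map
   is the product measure. *)
Let bits (x : R) : cantor_space := fun i => odd (Num.truncn (x * 2 ^+ i.+1)).

Let measurable_trunc (c : R) (k : nat) : 0 < c ->
  measurable [set x : R | Num.truncn (x * c) = k].
Proof.
move=> c0; case: k => [|k].
  have -> : [set x : R | Num.truncn (x * c) = 0%N] = `]-oo, c^-1[%classic.
    apply/seteqP; split=> x /=; rewrite in_itv/= -(ltr_pM2r c0) mulVf ?gt_eqF//.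
      by move/eqP; rewrite -leqn0 truncn_le_nat.
    by move=> h; apply/eqP; rewrite -leqn0 truncn_le_nat.
  exact: measurable_itv.
have -> : [set x : R | Num.truncn (x * c) = k.+1] =
    `[k.+1%:R / c, k.+2%:R / c[%classic.
  apply/seteqP; split=> x /=; rewrite in_itv/= ler_pdivrMr// ltr_pdivlMr//.
    by move=> h; rewrite -truncn_gt_nat -truncn_le_nat h leqnn.
  by move/truncn_def.
exact: measurable_itv.
Qed.

Let measurable_bits : measurable_fun [set: R] bits.
Proof.
apply: (measurability coordinate_sets) => //.
move=> _ [_ [n [B ->]] <-]; rewrite setTI.
have -> : bits @^-1` [set x | B (x n)] =
  \bigcup_(k in [set k | B (odd k)])
    [set x : R | Num.truncn (x * 2 ^+ n.+1) = k].
  apply/seteqP; split=> x /=; first by move=> h; exists (Num.truncn (x * 2 ^+ n.+1)).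
  by move=> [k /= Bk xk]; rewrite /bits xk.
by apply: bigcup_measurable => k _; apply: measurable_trunc; rewrite exprn_gt0.
Qed.

Let unit_itv : set R := `[0, 1[%classic.
Let munit : measurable unit_itv. Proof. exact: measurable_itv. Qed.


Let code (s : seq bool) : nat := foldl (fun (k : nat) (b : bool) => b + k.*2)%N 0%N s.

Let code_lt s : (code s < 2 ^ size s)%N.
Proof.
elim/last_ind: s => [//|s b]; rewrite /code foldl_rcons size_rcons expnS.
by case: b; lia.
Qed.

Let truncn_half (y : R) : 0 <= y -> (Num.truncn (y * 2))./2 = Num.truncn y.
Proof.
move=> y0; apply/esym/truncn_def.
have /andP[] := truncn_itv (mulr_ge0 y0 (ler0n R 2)).
set m := Num.truncn _; rewrite -{1 2}(odd_double_half m).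
move=> h1 h2.
have h3 : ((odd m) + (m./2).*2)%:R = (odd m)%:R + m./2%:R * 2 :> R.
  by rewrite natrD -muln2 natrM.
have h4 : (odd m + (m./2).*2).+1%:R = (odd m)%:R + m./2%:R * 2 + 1 :> R.
  by rewrite -addn1 natrD h3.
move: h1 h2; rewrite h3 h4 -(natr1 m./2).
by case: (odd m) => /=; lra.
Qed.

Let bits_code s x : 0 <= x < 1 ->
  (forall i, (i < size s)%N -> bits x i = nth false s i) <->
  Num.truncn (x * 2 ^+ size s) = code s.
Proof.
move=> /andP[x0 x1]; elim/last_ind: s => [|s b IH].
  split=> // _; rewrite expr0 mulr1; apply/eqP.
  by rewrite /code/= -leqn0 truncn_le_nat.
rewrite /code foldl_rcons size_rcons -/(code s).
have Th : (Num.truncn (x * 2 ^+ (size s).+1))./2 = Num.truncn (x * 2 ^+ size s).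
  by rewrite exprSr mulrA truncn_half// mulr_ge0// exprn_ge0.
split=> [h|h].
- have hb := h _ (leqnn _); rewrite nth_rcons ltnn eqxx in hb.
  have /IH hs : forall i, (i < size s)%N -> bits x i = nth false s i.
    by move=> i si; rewrite h ?ltnS 1?ltnW// nth_rcons si.
  by rewrite -(odd_double_half (Num.truncn _)) Th hs; congr addn; rewrite -hb.
- have hs : Num.truncn (x * 2 ^+ size s) = code s.
    by rewrite -Th h; case: b {h}; lia.
  move=> i; rewrite ltnS leq_eqVlt => /predU1P[->|si].
    rewrite nth_rcons ltnn eqxx /bits h oddD odd_double addbF.
    by case: b {h}.
  by rewrite nth_rcons si; move/IH: hs; apply.
Qed.

Let cyl (s : seq bool) : set cantor_space :=
  [set x | forall i, (i < size s)%N -> x i = nth false s i].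

Let cyl_measure s :
  lebesgue_measure ((bits @^-1` cyl s) `&` unit_itv) = ((2 ^- size s)%:E : \bar R).
Proof.
set n := size s; have n0 : (0 : R) < 2 ^+ n by rewrite exprn_gt0.
have -> : (bits @^-1` cyl s) `&` unit_itv =
    `[(code s)%:R / 2 ^+ n, (code s).+1%:R / 2 ^+ n[%classic.
  apply/seteqP; split=> x /=.
    move=> [h]; rewrite /unit_itv/= !in_itv/= => x01.
    move/(bits_code _ x01) : h => hc; rewrite ler_pdivrMr// ltr_pdivlMr// -hc.
    by apply: truncn_itv; case/andP: x01 => x0 _; rewrite mulr_ge0// ltW.
  rewrite in_itv/= ler_pdivrMr// ltr_pdivlMr// => h.
  have x01 : 0 <= x < 1.
    case/andP: h => h1 h2; apply/andP; split.
      by rewrite -(pmulr_lge0 _ n0) (le_trans _ h1).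
    rewrite -(ltr_pM2r n0) mul1r (lt_le_trans h2)// -natrX ler_nat.
    exact: code_lt.
  split; first by apply/(bits_code _ x01); exact: truncn_def.
  by rewrite /unit_itv/= in_itv.
rewrite lebesgue_measure_itv/= lte_fin ltr_pM2r ?invr_gt0// ltr_nat ltnSn.
by rewrite -EFinB -mulrBl -natrB// subSnn mul1r.
Qed.

Lemma product_measure_exists :
  exists mu : {measure set cantor_space -> \bar R}, is_product_measure mu.
Proof.
have [mu muE] : exists mu : {measure set cantor_space -> \bar R},
    forall A, mu A = lebesgue_measure ((bits @^-1` A) `&` unit_itv).
  unshelve eexists; first refine
    (pushforward (mrestr (@lebesgue_measure R) munit) bits
      : {measure set cantor_space -> \bar R}).
    exact: measurable_bits.
  by [].
exists mu.
have mcoord n (B : set bool) : measurable ([set x | B (x n)] : set cantor_space).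
  by apply: sub_sigma_algebra; exists n, B.
have mbox n (f : nat -> nat) (A : nat -> set bool) :
    measurable ([set x | forall i, (i < n)%N -> A i (x (f i))] : set cantor_space).
  rewrite [X in measurable X](_ : _ =
    \bigcap_(i in `I_n) [set x : cantor_space | A i (x (f i))]); last first.
    by apply/seteqP; split=> x /= h i; exact: h.
  by apply: bigcap_measurableType => // i _; exact: (mcoord (f i)).
pose q (B : set bool) : R := (\1_B true + \1_B false) / 2.
have nuE B : bernoulli_prob (2^-1 : R) B = (q B)%:E.
  rewrite bernoulli_probE; last by apply/andP; split; lra.
  rewrite !diracE -!EFinM -EFinD /q !indicE; congr EFin; by rewrite /unstable.onem; field.
have main k : forall s (A : nat -> set bool),
    mu (cyl s `&` [set x | forall i, (i < k)%N -> A i (x (size s + i)%N)]) =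
    (2 ^- size s * \prod_(i < k) q (A i))%:E.
  elim: k => [|k IH] s A.
    rewrite big_ord0 mulr1 -cyl_measure -muE; congr (mu _).
    by apply/seteqP; split=> x //= [].
  set E := _ `&` _.
  have mE : measurable E.
    apply: measurableI; last exact: (mbox k.+1 (fun i => size s + i)%N).
    exact: (mbox (size s) id (fun i b => b = nth false s i)).
  pose C b : set cantor_space := [set x | x (size s) = b].
  have mC b : measurable (C b) by exact: (mcoord (size s) (fun c => c = b)).
  have EC b : mu (E `&` C b) =
      (\1_(A 0%N) b * (2 ^- (size s).+1 * \prod_(i < k) q (A i.+1)))%:E.
    rewrite indicE; have [Ab|Ab] := pselect (A 0%N b).
      rewrite mem_set// mul1r -(size_rcons s b) -(IH (rcons s b) (fun i => A i.+1)).
      congr (mu _); apply/seteqP; split=> x /=.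
        move=> [[xs xA] xb]; split; last first.
          by move=> i ik; have := xA i.+1 ik; rewrite size_rcons addSnnS.
        move=> i; rewrite size_rcons ltnS leq_eqVlt nth_rcons.
        by move=> /predU1P[->|si]; [rewrite ltnn eqxx|rewrite si xs].
      move=> [xs xA].
      have xb : x (size s) = b.
        by rewrite xs ?size_rcons// nth_rcons ltnn eqxx.
      split=> //; split.
        by move=> i si; rewrite xs ?size_rcons ?ltnS 1?ltnW// nth_rcons si.
      move=> [_|i ik]; first by rewrite addn0 xb.
      by have := xA i ik; rewrite size_rcons addSnnS.
    rewrite memNset// mul0r (_ : _ `&` _ = set0) ?measure0//; apply/seteqP; split=> x //=.
    by move=> [[_ xA] xb]; apply: Ab; rewrite -xb -[size s]addn0; exact: xA.
  have -> : E = (E `&` C true) `|` (E `&` C false).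
    apply/seteqP; split=> x /=; last by move=> [[]|[]].
    by move=> Ex; case xs : (x (size s)); [left|right].
  rewrite measureU; [|exact: measurableI|exact: measurableI|]; last first.
    by apply/seteqP; split=> x //= [[_ h] [_]]; rewrite /C/= h.
  transitivity (mu (E `&` C true) + mu (E `&` C false))%E; first by [].
  rewrite (EC true) (EC false) -EFinD big_ord_recl /q exprS invfM; congr EFin.
  have -> : \prod_(i < k) ((\1_(A (bump 0 i)) true + \1_(A (bump 0 i)) false) / 2) =
    \prod_(i < k) q (A i.+1) :> R by [].
  by field; rewrite ?expf_neq0 ?pnatr_eq0.
move=> n A; under eq_bigr do rewrite nuE.
have := main n [::] A; rewrite expr0 invr1 mul1r -prodEFin => <-; congr (mu _); apply/seteqP; split=> x /=; first by move=> h; split.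
by move=> [].
Qed.

Lemma product_measure_unique (mu1 mu2 : {measure set cantor_space -> \bar R}) :
  is_product_measure mu1 -> is_product_measure mu2 ->
  forall A, measurable A -> mu1 A = mu2 A.
Proof.
move=> h1 h2; pose G := [set B | exists n A, B = box n A].
have GT : G setT.
  by exists 0%N, (fun=> setT); apply/seteqP; split.
apply: (measure_unique G (fun=> setT)) => //.
- apply/seteqP; split; apply: smallest_sub => //.
  + move=> _ [n [B ->]]; apply: sub_sigma_algebra.
    exists n.+1, (fun i => if i == n then B else setT); apply/seteqP; split=> x /=.
      by move=> xB i _; case: eqP => // ->.
    by move=> /(_ n (leqnn _)); rewrite eqxx.
  + exact: sigma_algebra_measurable.
  + move=> _ [n [A ->]].
    rewrite [X in measurable X](_ : _ =
      \bigcap_(i in `I_n) [set x : cantor_space | A i (x i)]).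
      apply: bigcap_measurableType => // i _.
      by apply: sub_sigma_algebra; exists i, (A i).
    by apply/seteqP; split=> x /= h i; exact: h.
- move=> _ _ [n [A ->]] [m [B ->]].
  exists (maxn n m), (fun i => [set b | ((i < n)%N -> A i b) /\ ((i < m)%N -> B i b)]).
  apply/seteqP; split=> x /=.
    by move=> [xA xB] i _; split=> [/xA|/xB].
  move=> h; split=> i im.
    by have [] := h i _; rewrite ?leq_max ?im// => /(_ isT).
  by have [] := h i _; rewrite ?leq_max ?im ?orbT// => _ /(_ isT).
- by rewrite bigcup_const//; exists 0%N.
- by move=> _ [n [A ->]]; rewrite h1 h2.
- move=> _; rewrite (_ : setT = box 0 (fun=> setT)).
    by rewrite h1 big_ord0 ltry.
  by apply/seteqP; split.
Qed.
End ProductMeasure.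

Definition product_measure (R : realType) : {measure set cantor_space -> \bar R} :=
  projT1 (cid (product_measure_exists R)).

Lemma product_measureP (R : realType) : is_product_measure (product_measure R).
Proof. exact: projT2 (cid (product_measure_exists R)). Qed.

Definition null (R : realType) : set (set cantor_space) :=
  [set A | (product_measure R).-negligible A].

(* Elements of 2^{<omega} are lists of booleans, with the value at 0 first;
   [mkseq x n] is the restriction of x to n. *)
Definition is_tree (T : set (seq bool)) : Prop :=
  T !=set0 /\ forall s t, prefix s t -> T t -> T s.

Definition splitting (T : set (seq bool)) : set (seq bool) :=
  [set s | [/\ T s, T (rcons s false) & T (rcons s true)]].

Definition branches (T : set (seq bool)) : set cantor_space :=
  [set x | forall n, T (mkseq x n)].

Definition perfect_tree (T : set (seq bool)) : Prop :=
  is_tree T /\ forall s, T s -> exists2 t, splitting T t & prefix s t.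

Definition level (n : nat) : set (seq bool) := [set s | size s = n].

Definition uniformly_perfect (T : set (seq bool)) : Prop :=
  perfect_tree T /\
  forall n, level n `&` T `<=` splitting T \/ level n `&` splitting T = set0.

Definition u0 : set (set cantor_space) :=
  [set A | forall T, uniformly_perfect T ->
    exists T', [/\ uniformly_perfect T', T' `<=` T & branches T' `&` A = set0]].

Definition cantor_add (x y : cantor_space) : cantor_space :=
  fun n => x n (+) y n.

Definition sumset (A B : set cantor_space) : set cantor_space :=
  [set cantor_add a b | a in A & b in B].

(* Main.v *)
Require Import Defs.
From mathcomp Require Import all_boot all_order all_algebra.
From mathcomp Require Import all_classical all_reals all_analysis.
From mathcomp Require Import zify lra.

Set Implicit Arguments.
Unset Strict Implicit.
Unset Printing Implicit Defensive.

Import Order.TTheory GRing.Theory Num.Theory.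

Local Open Scope classical_set_scope.
Local Open Scope ring_scope.

(** Why it is true.  Write [c] for the cardinality of 2^omega.  A uniformly
    perfect tree [T] contains [c] many uniformly perfect subtrees with pairwise
    disjoint sets of branches, all inside one very thin set [P] of branches of
    [T].  If [P] meets [L + S] in fewer than [c] points, one of these subtrees
    has no branch in [L + S].  So it suffices to find such a [P].

    For the smallness of [P `&` (L + S)], suppose there is a null set [N] for
    which [Q = (complement of N) + P] is meager, and that every translate of [P]
    is both null and meager.  Let [x = l + s] be a point of [P].  If [s] is not
    in [N], then [l = s + x] lies in [Q].  Hence either [l] lies in [L `&` Q] or
    [s] lies in [S `&` N], and both of these sets have fewer than [c] elements.
    For a fixed [l] the possible [x] correspond to the points of [S] in the null
    set [P + l], for a fixed [s] to the points of [L] in the meager set [P + s];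
    in both cases there are fewer than [c] of them.  Regularity of [c] bounds
    the union ([rigid_sumset_small]).

    To get [N] and [P], attach to each [m] a row of [2 ^ m] consecutive blocks of
    length [2 * m], starting at position [m], and let [N] be the set of points
    that vanish on some block of row [m], for infinitely many [m].  Row [m]
    contributes measure at most [2 ^ m * 2 ^ (- 2 * m)], so [N] is null by the
    Borel-Cantelli lemma ([null_hits]).  The set [P] is taken so sparsely
    splitting that for infinitely many [m] a point of [P] is determined up to the
    end of row [m] by its first [m] values ([rigid]).  These values form one of
    [2 ^ m] words, and there is one block for each: a finite condition may copy
    onto the block of each word the point of [P] which that word determines.  Any
    [y] extending this condition agrees with every [p] in [P] on some block of
    row [m], that is, [y + p] vanishes there, and this makes [Q] meager
    ([rigid_meager]).  The same blocks show that translates of [P] are null. *)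

(** * Cylinders in the Cantor space *)

Definition agree (n : nat) (x y : cantor_space) : Prop :=
  forall i, (i < n)%N -> x i = y i.

Lemma agree_nbhs (x : cantor_space) n : nbhs x [set y | agree n x y].
Proof.
elim: n => [|n IH]; first by apply: filterS filterT => y _ i.
have xn : nbhs x [set y : cantor_space | x n = y n].
  have /pointwise_cvgP/(_ n) : {ptws, nbhs x --> x} by exact: cvg_id.
  by move=> /(_ [set x n]) h; apply: filterS (h (discrete_set1 (x n))) => y ->.
apply: filterS (filterI IH xn) => y [yx yn] i.
by rewrite ltnS leq_eqVlt => /predU1P[->//|/yx].
Qed.

(** The cylinders around [x] generate a filter converging to [x] pointwise; as
    the topology is that of pointwise convergence, this filter contains every
    neighbourhood of [x]. *)
Lemma nbhs_agree (x : cantor_space) (U : set cantor_space) :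
  nbhs x U -> exists n, [set y | agree n x y] `<=` U.
Proof.
pose F := [set V : set cantor_space | exists n, [set y | agree n x y] `<=` V].
have FF : Filter F.
  split.
  - by exists 0%N.
  - move=> A B [n An] [m Bm]; exists (maxn n m) => y xy; split.
      by apply: An => i im; apply: xy; rewrite leq_max im.
    by apply: Bm => i im; apply: xy; rewrite leq_max im orbT.
  - by move=> A B AB [n An]; exists n; exact: subset_trans AB.
suff : {ptws, F --> x} by apply.
apply/pointwise_cvgP => i A xA; exists i.+1 => y /(_ i (leqnn _)) xy /=.
by rewrite -xy; exact: nbhs_singleton.
Qed.

(** * Null sets of points with infinitely many block coincidences *)

(** Position [i] inside block [c] of row [m]; a block of row [m] has length
    [m.*2] and the row starts at [m]. *)
Definition block_pos (m c i : nat) : nat := (m + c * m.*2 + i)%N.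

(** The target of a coincidence may vary with the block: a constant target gives
    the null set that splits 2^omega, a target running through a thin set gives
    the nullness of that set. *)
Definition hits (z : nat -> nat -> cantor_space) : set cantor_space :=
  [set x | forall a, exists2 m, (a <= m)%N & exists2 c, (c < 2 ^ m)%N &
    forall i, (i < m.*2)%N -> x (block_pos m c i) = z m c (block_pos m c i)].

Section Null.
Context (R : realType).
Local Notation mu := (product_measure R).

Lemma box_measurable n (A : nat -> set bool) : measurable (box n A).
Proof.
rewrite [X in measurable X](_ : _ =
    \bigcap_(i in `I_n) [set x : cantor_space | A i (x i)]); last first.
  by apply/seteqP; split=> x /= h i; exact: h.
apply: bigcap_measurableType => // i _.
by apply: sub_sigma_algebra; exists i, (A i).
Qed.

Lemma interval_box_measure (z : cantor_space) b n :
  mu (box (b + n) (fun i => [set v | (b <= i)%N -> v = z i])) =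
  ((2^-1 : R) ^+ n)%:E.
Proof.
have half A : bernoulli_prob (2^-1 : R) A =
    (2^-1 * (\1_A true + \1_A false))%:E.
  rewrite bernoulli_probE; last by apply/andP; split; lra.
  by rewrite !diracE -!EFinM -EFinD !indicE; congr EFin; rewrite /unstable.onem; lra.
rewrite product_measureP; under eq_bigr do rewrite half.
rewrite prodEFin; congr EFin.
rewrite big_split_ord/= big1 ?mul1r => [|i _]; last first.
  rewrite !indicE !mem_set/=; first by lra.
  - by rewrite leqNgt ltn_ord.
  - by rewrite leqNgt ltn_ord.
rewrite (eq_bigr (fun=> 2^-1)) => [|i _]; first by rewrite prodr_const card_ord.
have bi : (b <= rshift b i)%N by rewrite leq_addr.
rewrite !indicE; case: (z (rshift b i)).
- by rewrite mem_set// memNset ?addr0 ?mulr1// => /(_ bi).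
- by rewrite memNset ?mem_set ?add0r ?mulr1// => /(_ bi).
Qed.

(** In row [m] there are [2 ^ m] blocks and a coincidence on each has measure
    [2 ^- m.*2], so row [m] contributes at most [2 ^- m] and Borel-Cantelli
    applies. *)
Lemma null_hits z : null R (hits z).
Proof.
pose B m c := box ((m + c * m.*2) + m.*2)
  (fun i => [set v | (m + c * m.*2 <= i)%N -> v = z m c i]).
pose U m := \big[setU/set0]_(c < 2 ^ m) B m c.
have mB m c : measurable (B m c) by exact: box_measurable.
have mU m : measurable (U m) by exact: bigsetU_measurable.
exists (lim_sup_set U); split.
- by apply: bigcap_measurableType => // n _; exact: bigcup_measurable.
- apply: lim_sup_set_cvg0 => //.
  have le m : (mu (U m) <= ((2^-1 : R) ^+ m)%:E)%E.
    apply: le_trans (le_mu_bigsetU mu (fun c _ => mB m c)) _.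
    rewrite (eq_bigr (fun=> ((2^-1 : R) ^+ m.*2)%:E)) => [|c _]; last first.
      exact: interval_box_measure.
    rewrite sumEFin lee_fin sumr_const card_ord -[leLHS]mulr_natr natrX.
    rewrite -addnn exprD -mulrA -exprMn mulVf ?expr1n ?mulr1//.
  apply: (@le_lt_trans _ _ (\sum_(0 <= m <oo) ((2^-1 : R) ^+ m)%:E)%E).
    by apply: lee_nneseries => // m _; exact: le.
  have -> : (\sum_(0 <= m <oo) ((2^-1 : R) ^+ m)%:E)%E = (2 / 2 ^+ 0)%:E.
    apply/cvg_lim => //; have := @cvg_geometric_eseries_half R 2 0.
    rewrite (_ : (fun k => _) = (fun k => ((2^-1 : R) ^+ k)%:E))//.
    apply/funext => k; congr EFin; rewrite addn1 natrX exprS invfM mulrA.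
    by rewrite mulfV ?mul1r ?exprVn// pnatr_eq0.
  exact: ltry.
- move=> x xz a _; have [m am [c cm xc]] := xz a; exists m => //.
  rewrite /U -bigcup_mkord; exists c => // i; rewrite -addnA => ilt ige.
  have := xc (i - (m + c * m.*2))%N; rewrite /block_pos subnKC//; apply.
  by rewrite ltn_subLR// addnA in ilt *.
Qed.
End Null.

(** * Rigid sets *)

(** A numbering of the words of length [m] by the numbers below [2 ^ m], used to
    give each word its own block. *)
Fixpoint code (x : cantor_space) (m : nat) : nat :=
  if m is n.+1 then (x n + (code x n).*2)%N else 0%N.

Lemma code_lt x m : (code x m < 2 ^ m)%N.
Proof. by elim: m => //= m IH; rewrite expnS; case: (x m); lia. Qed.

Lemma code_agree x y m : code x m = code y m -> agree m x y.
Proof.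
elim: m => [//|m IH]/= xy i; have [xym cxy] : x m = y m /\ code x m = code y m.
  by move: xy; case: (x m); case: (y m); lia.
by rewrite ltnS leq_eqVlt => /predU1P[->//|]; exact: IH.
Qed.

(** The first position after the last block of row [m]. *)
Definition block_end (m : nat) : nat := (m + 2 ^ m * m.*2)%N.

Lemma block_pos_lt_end m c i :
  (c < 2 ^ m)%N -> (i < m.*2)%N -> (block_pos m c i < block_end m)%N.
Proof.
move=> cm im; rewrite /block_pos /block_end -addnA ltn_add2l.
by apply: (@leq_trans (c.+1 * m.*2)); rewrite ?leq_mul2r ?cm ?orbT// mulSn; lia.
Qed.

Definition rigid_at (P : set cantor_space) (m : nat) : Prop :=
  forall p q, P p -> P q -> agree m p q -> agree (block_end m) p q.

Definition rigid (P : set cantor_space) : Prop :=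
  forall a, exists2 m, (a <= m)%N & rigid_at P m.

(** The default value only occurs for codes that no point of [P] has. *)
Definition representative (P : set cantor_space) (m c : nat) : cantor_space :=
  xget (fun=> false) [set p | P p /\ code p m = c].

Lemma representativeP P m p : rigid_at P m -> P p ->
  agree (block_end m) (representative P m (code p m)) p.
Proof.
move=> Pm Pp; have [Pr cr] := xgetPex (fun=> false) (ex_intro
  (fun q => P q /\ code q m = code p m) p (conj Pp erefl)).
by apply: Pm => //; exact: code_agree.
Qed.

Lemma cantor_addKr x y : cantor_add (cantor_add x y) y = x.
Proof. by apply/funext => i; rewrite /cantor_add addbK. Qed.

Lemma cantor_addC x y : cantor_add x y = cantor_add y x.
Proof. by apply/funext => i; rewrite /cantor_add addbC. Qed.

(** In a row [m] where [P] is rigid, a point of [P] agrees with the representative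
    of its own code on the block carrying this code. *)
Lemma rigid_null_translate (R : realType) P l :
  rigid P -> null R [set y | P (cantor_add y l)].
Proof.
move=> rP; apply: negligibleS
  (null_hits R (fun m c => cantor_add (representative P m c) l)) => y/= Py a.
have [m am Pm] := rP a; exists m => //.
exists (code (cantor_add y l) m) => [|i im]; first exact: code_lt.
rewrite {2}/cantor_add (representativeP Pm Py) ?/cantor_add ?addbK//.
by apply: block_pos_lt_end => //; exact: code_lt.
Qed.

(** The set is the sum of [P] and the complement of a null set, so it is meager
    although it has full measure as soon as [P] is nonempty.  Given a cylinder, a
    rigid row [m] beyond it has a block for every code, hence room to imitate all
    points of [P] at once, each on its own block. *)
Lemma rigid_meager P z : rigid P ->
  meager [set y | exists2 p, P p & ~ hits (fun _ _ => z) (cantor_add y p)].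
Proof.
move=> rP; pose miss a := [set y | exists2 p, P p & forall m c, (a <= m)%N ->
  (c < 2 ^ m)%N -> exists2 i, (i < m.*2)%N &
    cantor_add y p (block_pos m c i) <> z (block_pos m c i)].
exists miss; last first.
  move=> y [p Pp] /existsNP[a /forall2NP ya]; exists a => //; exists p => // m c am cm.
  have [//|/forall2NP/(_ c)[//|/existsNP[i /not_implyP[im yi]]]] := ya m.
  by exists i.
move=> a; rewrite /nowhere_dense -subset0 => x /nbhs_agree[n xn].
have [m /[!geq_max]/andP[am nm] Pm] := rP (maxn a n).
(* On each block of row [m], [x'] is the representative of the code of this
   block, plus [z]: the quotient recovers the block from the position. *)
pose x' : cantor_space := fun i => if (i < m)%N then x i else
  representative P m ((i - m) %/ m.*2) i (+) z i.
have /xn/(_ _ (agree_nbhs x' (block_end m))) : agree n x x'.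
  by move=> i ni; rewrite /x' (leq_trans ni nm).
move=> [y [[p Pp yp] x'y]].
(* Contradiction on the block of the code of [p] itself. *)
have [i im] := yp m (code p m) am (code_lt p m); apply.
have ilt := block_pos_lt_end (code_lt p m) im.
rewrite /cantor_add -x'y// /x' /block_pos -addnA ltnNge leq_addr/= addKn.
rewrite divnMDl ?(leq_ltn_trans _ im)// (divn_small im) addn0 addnA.
by rewrite -/(block_pos _ _ _) (representativeP Pm Pp)// addbAC addbb addFb.
Qed.

(** For any [z], [P + l] is covered by the set of [rigid_meager] as soon as [l] has
    no infinite family of coincidences with [z]; the pointwise negation of [l]
    has none at all. *)
Lemma rigid_meager_translate P l :
  rigid P -> meager [set y | P (cantor_add y l)].
Proof.
move=> rP; have [F F0 FS] := rigid_meager (fun i => ~~ l i) rP.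
exists F => // y Py; apply: FS; exists (cantor_add y l) => //.
(* Rows are taken from 1 on, because the blocks of row 0 are empty. *)
move=> /(_ 1%N)[m m0 [c cm /(_ 0%N)]]; rewrite double_gt0 => /(_ m0).
by rewrite /cantor_add addKb; case: (l _).
Qed.

(** * Counting the points of a sumset in a rigid set *)

Lemma card_le_lt_trans T U V (A : set T) (B : set U) (C : set V) :
  (A #<= B)%card -> card_lt B C -> card_lt A C.
Proof.
move=> AB [BC CB]; split; first exact: card_le_trans BC.
by move=> CA; apply: CB; exact: card_le_trans AB.
Qed.

Lemma card_lt_le_trans T U V (A : set T) (B : set U) (C : set V) :
  card_lt A B -> (B #<= C)%card -> card_lt A C.
Proof.
move=> [AB BA] BC; split; first exact: card_le_trans BC.
by move=> CA; apply: BA; exact: card_le_trans CA.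
Qed.

(** Regularity speaks of unions indexed by subsets of the type itself, so the two
    sets are indexed by two of its points. *)
Lemma card_lt_setU (A B : set cantor_space) : regular_card cantor_space ->
  card_lt A [set: cantor_space] -> card_lt B [set: cantor_space] ->
  card_lt (A `|` B) [set: cantor_space].
Proof.
move=> [inf reg] ltA ltB.
pose I : set cantor_space := [set (fun=> true); (fun=> false)].
have ltI : card_lt I [set: cantor_space].
  split; first exact: card_leT.
  by move=> /card_le_finite h; apply: inf; apply: h; exact: finite_set2.
have -> : A `|` B = \bigcup_(i in I) (if i 0%N then A else B).
  apply/seteqP; split=> [x [Ax|Bx]|x [i [->|->] ?]]; [| |by left|by right].
    by exists (fun=> true) => //; left.
  by exists (fun=> false) => //; right.
by apply: reg => // i _; case: ifP.
Qed.

(** Since [x + a = b] means [x = b + a], the slice at [a] is a translated copy of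
    the set of points of [B] in the translate [P + a]. *)
Lemma card_lt_sum_slice (P A B : set cantor_space) : regular_card cantor_space ->
  card_lt A [set: cantor_space] ->
  (forall a, card_lt (B `&` [set y | P (cantor_add y a)]) [set: cantor_space]) ->
  card_lt (\bigcup_(a in A) [set x | P x /\ B (cantor_add x a)])
    [set: cantor_space].
Proof.
move=> [_ reg] ltA ltB; apply: reg => // a _; apply: card_le_lt_trans (ltB a).
rewrite (_ : [set x | _] =
  (cantor_add ^~ a) @^-1` (B `&` [set y | P (cantor_add y a)])).
  apply: card_ge_preimage => x y _ _ xy.
  by rewrite -(cantor_addKr x a) xy cantor_addKr.
by apply/seteqP; split=> x /=; rewrite cantor_addKr => -[].
Qed.

(** For [x = l + s] in [P], [s] lies in a null set [N] or [l = x + s] lies in the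
    meager set [Q], so one of the summands ranges over a small set; for a fixed
    value of that summand, the other one lies in a translate of [P], which is
    both null and meager. *)
Lemma rigid_sumset_small (R : realType) (L S P : set cantor_space) :
  regular_card cantor_space -> luzin (@meager cantor_space) L ->
  luzin (null R) S -> rigid P ->
  card_lt (P `&` sumset L S) [set: cantor_space].
Proof.
move=> hc hL hS rP; pose N := hits (fun _ _ => fun=> false).
pose Q := [set y | exists2 p, P p & ~ N (cantor_add y p)].
have ltL A : meager A -> card_lt (L `&` A) [set: cantor_space].
  by move=> mA; apply: card_lt_le_trans (card_leT L); exact: hL.
have ltS A : null R A -> card_lt (S `&` A) [set: cantor_space].
  by move=> nA; apply: card_lt_le_trans (card_leT S); exact: hS.
apply: (@card_le_lt_trans _ _ _ _
  (\bigcup_(l in L `&` Q) [set x | P x /\ S (cantor_add x l)] `|`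
   \bigcup_(s in S `&` N) [set x | P x /\ L (cantor_add x s)])).
  apply: subset_card_le => x [Px [l Ll [s Ss lsx]]].
  have xs : cantor_add x s = l by rewrite -lsx cantor_addKr.
  have xl : cantor_add x l = s by rewrite -lsx (cantor_addC l) cantor_addKr.
  have [Ns|Ns] := pselect (N s); [right; exists s|left; exists l] => //=.
  - by rewrite xs.
  - by split => //; exists x => //; rewrite cantor_addC xl.
  - by rewrite xl.
apply: card_lt_setU => //; apply: card_lt_sum_slice => //.
- by apply: ltL; exact: rigid_meager.
- by move=> l; apply: ltS; exact: rigid_null_translate.
- by apply: ltS; exact: null_hits.
- by move=> s; apply: ltL; exact: rigid_meager_translate.
Qed.

(** * Pruning uniformly perfect trees *)

Definition full_level (T : set (seq bool)) : set nat :=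
  [set n | level n `&` T `<=` splitting T].

(** Fixing values at the full levels in [C] is enough to describe the subtrees
    needed here.  At the levels that are not full nothing can be chosen: each
    node has a single successor there, which may depend on the node. *)
Definition prune (T : set (seq bool)) (C : set nat) (w : cantor_space) :
    set (seq bool) :=
  [set s | T s /\ forall n, (n < size s)%N -> C n -> nth false s n = w n].

Lemma uniformly_perfect_nil T : uniformly_perfect T -> T [::].
Proof.
by move=> [[[[s Ts] pT] _] _]; apply: pT Ts; exact: prefix0s.
Qed.

Lemma splitting_full_level T s :
  uniformly_perfect T -> splitting T s -> full_level T (size s).
Proof.
move=> [_ /(_ (size s))[//|T0] sT].
by have : set0 s by rewrite -T0; split.
Qed.

Lemma uniformly_perfect_rcons T s : uniformly_perfect T -> T s ->
  exists b, T (rcons s b).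
Proof.
move=> uT Ts; have [[[_ pT] perfT] _] := uT.
have [t [Tt Tt0 Tt1] /prefixP[[|b u] tE]] := perfT s Ts.
  by exists false; rewrite cats0 in tE; rewrite -tE.
exists b; apply: pT Tt; rewrite tE -cat_rcons; exact: prefix_prefix.
Qed.

Lemma rcons_extend (T : set (seq bool)) s n :
  (forall s, T s -> exists b, T (rcons s b)) -> T s -> (size s <= n)%N ->
  exists t, [/\ prefix s t, size t = n & T t].
Proof.
move=> ext Ts; elim: n => [|n IH].
  by rewrite leqn0 => /eqP s0; exists s; rewrite prefix_refl.
rewrite leq_eqVlt => /predU1P[sn|/IH[t [st tn Tt]]].
  by exists s; rewrite prefix_refl.
have [b Ttb] := ext t Tt; exists (rcons t b); rewrite size_rcons tn; split => //.
by apply: prefix_trans st _; exact: prefix_rcons.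
Qed.

(** By perfectness there are splitting nodes above a node of height [a], and by
    uniformity the level of a splitting node is full. *)
Lemma full_level_cofinal T a : uniformly_perfect T ->
  exists2 n, (a <= n)%N & full_level T n.
Proof.
move=> uT; have [s [_ sa Ts]] :=
  rcons_extend (fun s => @uniformly_perfect_rcons T s uT)
    (uniformly_perfect_nil uT) (leq0n a).
have [t spt st] := uT.1.2 s Ts; exists (size t).
  by rewrite -sa; exact: size_prefix.
exact: splitting_full_level.
Qed.

Lemma prune_sub T C w : prune T C w `<=` T.
Proof. by move=> s []. Qed.

Lemma prune_rcons T C w s b : prune T C w s -> T (rcons s b) ->
  (C (size s) -> b = w (size s)) -> prune T C w (rcons s b).
Proof.
move=> [_ sw] Tsb bw; split => // n; rewrite size_rcons ltnS nth_rcons.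
by rewrite leq_eqVlt => /predU1P[->|ns]; [rewrite ltnn eqxx|rewrite ns; exact: sw].
Qed.

(** The levels that split in the pruned tree are exactly the full levels of [T]
    outside [C]; infinitely many of them are needed for perfectness. *)
Lemma uniformly_perfect_prune T C w : uniformly_perfect T ->
  C `<=` full_level T ->
  (forall a, exists n, [/\ (a <= n)%N, full_level T n & ~ C n]) ->
  uniformly_perfect (prune T C w).
Proof.
move=> uT CT free; have [[[_ pT] _] _] := uT.
have ext s : prune T C w s -> exists b, prune T C w (rcons s b).
  move=> sP; have [Cs|Cs] := pselect (C (size s)).
    have [_ s0 s1] : splitting T s by apply: CT Cs _ _; split => //; exact: sP.1.
    by exists (w (size s)); apply: prune_rcons => //; case: (w _).
  have [b sb] := uniformly_perfect_rcons uT sP.1.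
  by exists b; exact: prune_rcons.
have split_free s : prune T C w s -> full_level T (size s) -> ~ C (size s) ->
    splitting (prune T C w) s.
  move=> sP fs Cs; have [_ s0 s1] := fs s (conj erefl sP.1).
  by split => //; apply: prune_rcons.
split; first split; first split.
- by exists [::]; split => //; exact: uniformly_perfect_nil.
- move=> s t /prefixP[u ->] [Tt tw]; split; first by apply: pT Tt; exact: prefix_prefix.
  move=> n ns Cn; rewrite -tw ?nth_cat ?ns// size_cat.
  by apply: leq_trans ns _; rewrite leq_addr.
- move=> s sP; have [n [sn fn Cn]] := free (size s).
  have [t [st tn tP]] := rcons_extend ext sP sn; exists t => //.
  by apply: split_free => //; rewrite tn.
- move=> n; have [[fn Cn]|nf] := pselect (full_level T n /\ ~ C n).
    by left=> s [sn sP]; apply: split_free => //; rewrite sn.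
  right; rewrite -subset0 => s [sn [sP s0 s1]]; apply: nf.
  have sT : splitting T s by split; [exact: sP.1|exact: s0.1|exact: s1.1].
  have fs := splitting_full_level uT sT; rewrite -sn; split => // Cs.
  have nthE b : prune T C w (rcons s b) -> b = w (size s).
    move=> [_ /(_ (size s))]; rewrite size_rcons nth_rcons ltnn eqxx.
    by apply.
  by have := nthE _ s0; rewrite -(nthE _ s1).
Qed.

Lemma branches_prune T C w x : branches (prune T C w) x ->
  branches T x /\ forall n, C n -> x n = w n.
Proof.
move=> xP; split=> [n|n Cn]; first exact: (xP n).1.
have [_ /(_ n)] := xP n.+1; rewrite size_mkseq nth_mkseq//; exact.
Qed.

(** * Sparse branches and continuum many disjoint subtrees *)

Lemma sparse_sequence (D : set nat) (g : nat -> nat) :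
  (forall a, exists2 n, (a <= n)%N & D n) -> (forall n, (n <= g n)%N) ->
  exists e : nat -> nat,
    [/\ forall k, D (e k), forall k, (g (e k).+1 <= e k.+1)%N &
        {mono e : m n / (m <= n)%N}].
Proof.
move=> Dinf gn; have /choice[f fP] : forall a, exists n, (a <= n)%N /\ D n.
  by move=> a; have [n] := Dinf a; exists n.
pose e := fix e k := if k is l.+1 then f (g (e l).+1) else f 0%N.
have eg k : (g (e k).+1 <= e k.+1)%N by exact: (fP _).1.
exists e; split => //; first by case=> [|k]; exact: (fP _).2.
by apply: leq_mono; apply: homo_ltn ltn_trans _ => k; exact: leq_trans (gn _) (eg k).
Qed.

Section SparseBranches.
Variables (T : set (seq bool)) (e : nat -> nat).

(** The levels [e k] carry all the branching that is left. *)
Definition sparse_branches : set cantor_space :=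
  [set x | branches T x /\
    forall n, full_level T n -> ~ range e n -> x n = false].

(** After the level [e k] nothing splits before [e k.+1], which lies beyond the
    end of row [(e k).+1]: two sparse branches which agree up to and including
    the level [e k] agree throughout that row. *)
Lemma rigid_sparse_branches : uniformly_perfect T ->
  {mono e : m n / (m <= n)%N} ->
  (forall k, (block_end (e k).+1 <= e k.+1)%N) ->
  rigid sparse_branches.
Proof.
move=> uT emono egap a.
have elt := leqW_mono emono.
exists (e a).+1.
  elim: a => // a IH; by apply: (leq_trans IH); rewrite elt.
move=> p q [Tp p0] [Tq q0] pq i.
elim/ltn_ind: i => i IH ilt; have [ia|ai] := ltnP i (e a).+1; first exact: pq.
have pqi : mkseq p i = mkseq q i.
  apply: (@eq_from_nth _ false); rewrite !size_mkseq// => j ji.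
  by rewrite !nth_mkseq// IH// (ltn_trans ji).
have ie : ~ range e i.
  move=> [k _ ki]; move: ai (leq_trans ilt (egap a)).
  by rewrite -ki !elt ltnS => ak /(leq_trans ak); rewrite ltnn.
(* At a level that is not full, two different successors of the common node
   [mkseq p i] would make it a splitting node. *)
have [fi|nfi] := pselect (full_level T i); first by rewrite p0 ?q0.
apply: contra_notP nfi => /eqP pqi'.
rewrite -(size_mkseq p i); apply: splitting_full_level => //.
have := Tp i.+1; have := Tq i.+1; rewrite !mkseqS -pqi.
by move: pqi'; case: (p i); case: (q i) => // _ h1 h2; split => //; exact: Tp.
Qed.

(** The levels [e k] with [k] odd stay free, so that fixing the values at the
    coded levels leaves a perfect tree; those with [k] even store the bits of a
    point [y], so that different [y] give disjoint sets of branches. *)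
Definition coded_levels : set nat :=
  [set n | full_level T n /\ ~ exists k, n = e k.*2.+1].

Definition code_point (y : cantor_space) : cantor_space :=
  fun n => `[< exists2 k, n = e k.*2 & y k >].

Lemma uniformly_perfect_coded y : uniformly_perfect T ->
  {mono e : m n / (m <= n)%N} -> (forall k, full_level T (e k)) ->
  uniformly_perfect (prune T coded_levels (code_point y)).
Proof.
move=> uT emono eT; apply: uniformly_perfect_prune => // [n []//|a].
exists (e a.*2.+1); split => //; last by move=> [_]; apply; exists a.
have: (a <= e a)%N; last by move=> /leq_trans; apply; rewrite emono; lia.
by elim: a => // a IH; apply: leq_ltn_trans IH _; rewrite (leqW_mono emono).
Qed.

Lemma branches_coded_sparse y :
  branches (prune T coded_levels (code_point y)) `<=` sparse_branches.
Proof.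
move=> x /branches_prune[Tx xw]; split => // n fn ne.
rewrite xw; last by split => // -[k nk]; apply: ne; exists k.*2.+1.
by apply/asboolPn => -[k nk _]; apply: ne; exists k.*2.
Qed.

Lemma branches_coded_decode y x :
  {mono e : m n / (m <= n)%N} -> (forall k, full_level T (e k)) ->
  branches (prune T coded_levels (code_point y)) x ->
  y = (fun k => x (e k.*2)).
Proof.
move=> emono eT /branches_prune[_ xw]; have einj := incn_inj emono.
apply/funext => k; rewrite xw; last by split => // -[l /einj]; lia.
apply/idP/asboolP => [yk|[l /einj kl yl]]; first by exists k.
by rewrite (_ : k = l)//; lia.
Qed.

End SparseBranches.

Theorem corollary15 (R : realType) (hc : regular_card cantor_space)
    (L S : set cantor_space)
    (hL : luzin (@meager cantor_space) L) (hS : luzin (null R) S) :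
  u0 (sumset L S).
Proof.
move=> T uT.
have le_end n : (n <= block_end n)%N by rewrite leq_addr.
have [e [eT egap emono]] :=
  sparse_sequence (fun a => full_level_cofinal a uT) le_end.
have [_ small] := rigid_sumset_small hc hL hS
  (rigid_sparse_branches uT emono egap).
have [y y0] : exists y,
    branches (prune T (coded_levels T e) (code_point e y)) `&` sumset L S = set0.
  (* Otherwise reading the stored bits maps [P `&` (L + S)] onto 2^omega. *)
  apply: contra_notP small => /forallNP meet.
  apply: card_le_trans (card_image_le (fun (x : cantor_space) k => x (e k.*2)) _).
  apply: subset_card_le => y _.
  have /eqP/set0P[x [xy xLS]] := meet y.
  exists x; first by split=> //; exact: branches_coded_sparse xy.
  by rewrite -(branches_coded_decode emono eT xy).
exists (prune T (coded_levels T e) (code_point e y)); split => //.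
- exact: uniformly_perfect_coded.
- exact: prune_sub.
Qed.
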